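(* Let $0<p\le 2$. Let $u\in H^p$, $u\neq 0$, with Haar expansion $u=\sum_{I\in\mathcal D}x_Ih_I$ and atomic decomposition $(u_i,\mathcal G_i,I_i)_{i\in\mathcal N}$. Then the sequence $(\omega_I)_{I\in\mathcal D}$ defined by $$\omega_I=\frac{1}{A_p}\,\frac{|I_i|^{1-\frac p2}}{\|u_i\|_2^{2-p}}\,\frac{|x_I|^2|I|}{\|u\|_{H^p}^p},\qquad I\in\mathcal G_i,\ i\in\mathcal N,$$ (with $\omega_I:=0$ whenever $x_I=0$) satisfies $$\sum_{I\in\mathcal D}\omega_I\le 1,$$ and there exists a constant $C_p>0$ (depending only on $p$) such that for each $\varphi=(\varphi_I)_{I\in\mathcal D}\in\ell^\infty(\mathcal D)$ $$\|\varphi\cdot u\|_{H^p}\le C_p\,\|u\|_{H^p}\Big(\sum_{I\in\mathcal D}|\varphi_I|^2\omega_I\Big)^{\frac12}.$$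
   Context: Dyadic intervals: $\mathcal D$ is the set of all intervals $\left[\frac{k-1}{2^n},\frac{k}{2^n}\right)$ with $n\in\mathbb N_0$, $1\le k\le 2^n$; $|I|$ is the length of $I$. $\ell^\infty(\mathcal D)$ is the space of bounded real sequences indexed by $\mathcal D$. The Haar function $h_I$ is $1$ on the left half of $I$, $-1$ on the right half, $0$ elsewhere. Hardy spaces: for a real sequence $f=(x_I)_{I\in\mathcal D}$, identified with its formal Haar series $\sum_{I\in\mathcal D} x_Ih_I$, put $S(f)(t)=\big(\sum_{I\in\mathcal D}x_I^21_I(t)\big)^{1/2}$, $t\in[0,1]$, and $\|f\|_{H^p}=\|S(f)\|_{L^p([0,1])}$. $H^p$ ($0<p\le2$) is the set of all $f$ with $\|f\|_{H^p}<\infty$ (a quasi-norm if $p<1$). We write $\|f\|_2=\|f\|_{H^2}$, so $\|f\|_2^2=\sum_I x_I^2|I|$. For $u=\sum x_Ih_I$ and $\varphi\in\ell^\infty(\mathcal D)$, $\varphi\cdot u=\sum_{I\in\mathcal D}\varphi_Ix_Ih_I$. Blocks: a collection $\mathcal C\subseteq\mathcal D$ is a block of dyadic intervals if it has a unique maximal interval $I$ (with respect to inclusion) and, whenever $J\in\mathcal C$, $K\in\mathcal D$ and $J\subseteq K\subseteq I$, then $K\in\mathcal C$. The Carleson constant of a non-empty $\mathcal E\subseteq\mathcal D$ is $\llbracket\mathcal E\rrbracket=\sup_{I\in\mathcal E}\frac1{|I|}\sum_{J\in\mathcal E,\,J\subseteq I}|J|$. Atomic decomposition (known result): for every $0<p\le2$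 there is a constant $A_p$, depending only on $p$ and fixed once and for all, such that every $u=\sum_{J\in\mathcal D} x_Jh_J\in H^p$ admits an atomic decomposition, i.e. an index set $\mathcal N\subseteq\mathbb N$ and blocks of dyadic intervals $(\mathcal G_i)_{i\in\mathcal N}$ such that, with $u_i=\sum_{J\in\mathcal G_i}x_Jh_J$: (i) $(\mathcal G_i)_{i\in\mathcal N}$ is a disjoint partition of $\mathcal D$; (ii) $I_i:=\bigcup_{J\in\mathcal G_i}J$ is a dyadic interval and $\mathcal E:=\{I_i:i\in\mathcal N\}$ satisfies $\llbracket\mathcal E\rrbracket\le4$; (iii) $\|u\|_{H^p}^p\le\sum_{i\in\mathcal N}\|u_i\|_{H^p}^p\le\sum_{i\in\mathcal N}|I_i|\,\|S(u_i)\|_\infty^p\le A_p\|u\|_{H^p}^p$. The family $(u_i,\mathcal G_i,I_i)_{i\in\mathcal N}$ is called an atomic decomposition of $u$. *)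

(* Defs.v *)
From HB Require Import structures.
From mathcomp Require Import all_boot all_order all_algebra.
From mathcomp Require Import all_classical all_reals all_analysis.
Set Implicit Arguments.
Unset Strict Implicit.
Unset Printing Implicit Defensive.
Import Order.TTheory GRing.Theory Num.Theory.
Import numFieldNormedType.Exports.
Local Open Scope classical_set_scope.
Local Open Scope ring_scope.

(* [existT _ n k] stands for the interval [k / 2^n, (k+1) / 2^n), 0 <= k < 2^n;
   different indices give different intervals. *)
Definition dyadic := {n : nat & 'I_(2 ^ n)}.

Section Definitions.
Variable R : realType.
Implicit Types (I J K : dyadic) (p A : R) (x : dyadic -> R) (C E : set dyadic).
Implicit Types (N : set nat) (G : nat -> set dyadic) (top : nat -> dyadic).

Definition dint I : set R :=
  `[(tagged I)%:R / 2 ^+ tag I, (tagged I).+1%:R / 2 ^+ tag I[.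

Definition dlen I : R := (2 ^+ tag I)^-1.

Definition lebesgue01 : {measure set (measurableTypeR R) -> \bar R} :=
  mrestr lebesgue_measure (@measurable_itv R `[0, 1]).

(* A Haar series is identified with its coefficient sequence x. Square function
   and norms take values in the extended reals, so that they are defined for
   every sequence. *)
Definition square_fun x (t : R) : \bar R :=
  sqrte (\esum_(I in [set: dyadic]) (x I ^+ 2 * \1_(dint I) t)%:E).

Definition Hnorm p x : \bar R := Lnorm lebesgue01 p%:E (square_fun x).

Definition in_Hardy p x : Prop := (Hnorm p x < +oo)%E.

Definition restr_coef C x : dyadic -> R := fun J => x J * \1_C J.

Definition is_maximal C I : Prop :=
  C I /\ forall J, C J -> dint I `<=` dint J -> J = I.

Definition is_block C : Prop :=
  exists I, unique (is_maximal C) I /\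
    forall J K, C J -> dint J `<=` dint K -> dint K `<=` dint I -> C K.

Definition carleson E : \bar R :=
  ereal_sup [set ((dlen I)^-1%:E *
    \esum_(J in E `&` [set J | dint J `<=` dint I]) (dlen J)%:E)%E | I in E].

(* [N] is the index set, [G i] the i-th block, [restr_coef (G i) x] the atom u_i
   and [top i] the dyadic interval I_i. *)
Record atomic_decomposition p A x N G top : Prop := AtomicDecomposition {
  atomic_block : forall i, N i -> is_block (G i) ;
  atomic_trivIset : trivIset N G ;
  atomic_cover : \bigcup_(i in N) G i = [set: dyadic] ;
  atomic_top : forall i, N i -> dint (top i) = \bigcup_(J in G i) dint J ;
  atomic_carleson : (carleson (top @` N) <= 4%:E)%E ;
  atomic_lower :
    (Hnorm p x `^ p <= \esum_(i in N) Hnorm p (restr_coef (G i) x) `^ p)%E ;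
  atomic_middle :
    (\esum_(i in N) Hnorm p (restr_coef (G i) x) `^ p <=
     \esum_(i in N) ((dlen (top i))%:E *
        Lnorm lebesgue01 +oo (square_fun (restr_coef (G i) x)) `^ p))%E ;
  atomic_upper :
    (\esum_(i in N) ((dlen (top i))%:E *
        Lnorm lebesgue01 +oo (square_fun (restr_coef (G i) x)) `^ p) <=
     A%:E * Hnorm p x `^ p)%E }.

Definition atomic_constant p A : Prop :=
  forall x, in_Hardy p x -> exists N G top, atomic_decomposition p A x N G top.

(* The index of the block containing I (0 if there is none, which does not
   happen when the blocks G i, i in N, partition the dyadic intervals). *)
Definition block_index N G I : nat := xget 0%N [set i | N i /\ G i I].

(* For an atomic decomposition of x in H^p both norms below are finite, so
   [fine] loses nothing. *)
Definition omega p A x N G top I : R :=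
  if x I == 0 then 0 else
  let i := block_index N G I in
  A^-1 * (dlen (top i) `^ (1 - p / 2) /
          fine (Hnorm 2 (restr_coef (G i) x)) `^ (2 - p)) *
  (`|x I| ^+ 2 * dlen I / fine (Hnorm p x) `^ p).

End Definitions.

(* Main.v *)
Require Import Defs.
From mathcomp Require Import all_boot all_order all_algebra.
From mathcomp Require Import all_classical all_reals all_analysis.
From mathcomp Require Import measure_function measure_negligible.
From mathcomp Require Import measurable_realfun ess_sup_inf ring lra.
Set Implicit Arguments.
Unset Strict Implicit.
Unset Printing Implicit Defensive.
Import Order.TTheory GRing.Theory Num.Theory.
Import numFieldNormedType.Exports.
Local Open Scope classical_set_scope.
Local Open Scope ring_scope.

(** Put [s = p / 2]. Since [s <= 1], the map [y `^ s] is subadditive, so the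
    [p]-th power of the norm of [phi x] is at most the sum over the blocks
    [G i] of [\int (S(phi u_i)^2) `^ s]. With [L = |I_i|], [E = ||u_i||_2^2] and
    [t = \sum_I |phi_I|^2 omega_I], bound [y `^ s] on [I_i] by its tangent at
    [t * E / L]: the i-th integral is at most [t `^ s] times
    [(s / t) L^(1-s) E^(s-1) ||phi u_i||_2^2 + (1 - s) L^(1-s) E^s].
    The first terms sum up to [s A ||u||^p] by definition of [omega]; and
    [L^(1-s) E^s <= |I_i| ||S(u_i)||_oo^p] with (iii) bounds the second ones by
    [(1 - s) A ||u||^p]. Hence [C = A^(1/p)] works; the same bound on
    [L^(1-s) E^s] gives [\sum_I omega_I <= 1]. *)

(** * Sums over countable index sets: reindexing, regrouping and integration *)

Section CountableSums.
Local Open Scope ereal_scope.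

(** Transports a family on [D] to a sequence along the coding of [T], so that results on series over
    the natural numbers apply. Codes of no element of [D] carry the value 0. *)
Definition pickle_seq {R : realType} {T : countType} (D : set T)
    (a : T -> \bar R) (n : nat) : \bar R :=
  if pickle_inv n is Some i then (if i \in D then a i else 0) else 0.

Lemma pickle_seq_ge0 (R : realType) (T : countType) (D : set T)
    (a : T -> \bar R) n :
  (forall i, D i -> 0 <= a i) -> 0 <= pickle_seq D a n.
Proof.
move=> a0; rewrite /pickle_seq; case: pickle_inv => // i.
by case: ifPn => // /set_mem; exact: a0.
Qed.

(** Nonzero terms of the sequence occur only at codes, and [pickle] is injective, so reindexing
    along it loses and repeats nothing. *)
Lemma esum_nneseries (R : realType) (T : countType) (D : set T)
    (a : T -> \bar R) : (forall i, D i -> 0 <= a i) ->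
  \esum_(i in D) a i = \sum_(0 <= n <oo) pickle_seq D a n.
Proof.
move=> a0; rewrite nneseries_esumT; last by move=> n; exact: pickle_seq_ge0.
have -> : \esum_(n in [set: nat]) pickle_seq D a n =
    \esum_(n in range (@pickle T)) pickle_seq D a n.
  rewrite [RHS]esum_mkcond; apply: eq_esum => n _; case: ifPn => // /negP nT.
  rewrite /pickle_seq; move: (@pickle_invK T n); case: pickle_inv => // i /= ni.
  by exfalso; apply: nT; rewrite inE; exists i.
rewrite esum_image; last by apply: in2W; exact: (pcan_inj pickleK).
rewrite esum_mkcond; apply: eq_esum => i _.
by rewrite /pickle_seq pickleK_inv.
Qed.

Lemma esum_ge_term (R : realType) (T : choiceType) (D : set T) (a : T -> \bar R)
    (i : T) : (forall j, D j -> 0 <= a j) -> D i -> a i <= \esum_(j in D) a j.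
Proof.
move=> a0 Di; rewrite -(esum_set1 (a0 _ Di)) [leRHS](esumID [set i])//.
have -> : D `&` [set i] = [set i] by apply/setIidPr => _ ->.
by rewrite leeDl// esum_ge0// => j [Dj _]; exact: a0.
Qed.

Lemma esum_partition (R : realType) (T : choiceType) (N : set nat)
    (G : nat -> set T) (a : T -> \bar R) :
  trivIset N G -> \bigcup_(i in N) G i = setT -> (forall j, 0 <= a j) ->
  \esum_(j in setT) a j = \esum_(i in N) \esum_(j in G i) a j.
Proof.
(* [esum_bigcupT] takes a disjoint family indexed by all naturals; indices outside [N] receive the
   empty set. *)
move=> tG cG a0; pose H i := if i \in N then G i else set0.
have tH : trivIset setT H.
  move=> i j _ _; rewrite /H; case: ifPn => [/set_mem Ni|_]; last by rewrite set0I => -[].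
  case: ifPn => [/set_mem Nj|_]; last by rewrite setI0 => -[].
  exact: tG.
have HE i : N i -> H i = G i by move=> Ni; rewrite /H mem_set.
rewrite -cG -(eq_bigcupr HE) esum_bigcupT//.
by apply: eq_esum => i Ni; rewrite HE.
Qed.

Lemma esumZl (R : realType) (T : countType) (D : set T) (a : T -> \bar R)
    (k : R) : (forall i, D i -> 0 <= a i) -> (0 <= k)%R ->
  \esum_(i in D) (k%:E * a i) = k%:E * \esum_(i in D) a i.
Proof.
move=> a0 k0; rewrite !esum_nneseries//; last first.
  by move=> i Di; rewrite mule_ge0 ?lee_fin// a0.
rewrite -nneseriesZl; last by move=> n _; exact: pickle_seq_ge0.
apply: eq_eseriesr => n _; rewrite /pickle_seq.
by case: pickle_inv => [i|]; [case: ifP|]; rewrite ?mule0.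
Qed.

Context d (X : measurableType d) (R : realType) (mu : {measure set X -> \bar R}).

Lemma measurable_pickle_seq (T : countType) (D : set T) (f : T -> X -> \bar R) n :
  (forall i, D i -> measurable_fun setT (f i)) ->
  measurable_fun setT (fun t => pickle_seq D (f^~ t) n).
Proof.
move=> mf; rewrite /pickle_seq; case: pickle_inv => [i|]; last exact: measurable_cst.
by case: (boolP (i \in D)) => [Di|_]; [apply: mf; exact: set_mem|exact: measurable_cst].
Qed.

Lemma measurable_esum (T : countType) (D : set T) (f : T -> X -> \bar R) :
  (forall i t, D i -> 0 <= f i t) ->
  (forall i, D i -> measurable_fun setT (f i)) ->
  measurable_fun setT (fun t => \esum_(i in D) f i t).
Proof.
move=> f0 mf.
rewrite (_ : (fun t => _) =
  fun t => \sum_(0 <= n <oo | n \in predT) pickle_seq D (f^~ t) n); last first.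
  by apply/funext => t; apply: esum_nneseries => i; exact: f0.
apply: ge0_emeasurable_sum => [n t _ _|n _].
  by apply: pickle_seq_ge0 => i; exact: f0.
exact: measurable_pickle_seq.
Qed.

(** Monotone convergence, through the series form of the sum. It serves twice: for sums over dyadic
    intervals and for sums over blocks. *)
Lemma integral_esum (T : countType) (D : set T) (f : T -> X -> \bar R) :
  (forall i t, D i -> 0 <= f i t) ->
  (forall i, D i -> measurable_fun setT (f i)) ->
  \int[mu]_t (\esum_(i in D) f i t) = \esum_(i in D) \int[mu]_t f i t.
Proof.
move=> f0 mf.
rewrite (eq_integral (fun t => \sum_(0 <= n <oo) pickle_seq D (f^~ t) n)); last first.
  by move=> t _; apply: esum_nneseries => i; exact: f0.
rewrite integral_nneseries//; last 2 first.
  by move=> n; exact: measurable_pickle_seq.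
  by move=> n t _; apply: pickle_seq_ge0 => i; exact: f0.
rewrite esum_nneseries; last by move=> i Di; apply: integral_ge0 => t _; exact: f0.
apply: eq_eseriesr => n _; rewrite /pickle_seq.
by case: pickle_inv => [i|]; [case: ifP => _ //|]; rewrite integral0.
Qed.

End CountableSums.

(** * Inequalities for powers with exponent in ]0, 1] *)

Section Concavity.
Local Open Scope ereal_scope.

(* If [T := \sum_i g_i `^ s] is finite, each [g_i] is at most
   [g_i `^ s * T `^ (s^-1 - 1)]; sum over [i]. *)
Lemma poweR_esum_le (R : realType) (T : countType) (D : set T) (g : T -> \bar R)
    (s : R) : (0 < s)%R -> (s <= 1)%R -> (forall i, D i -> 0 <= g i) ->
  (\esum_(i in D) g i) `^ s <= \esum_(i in D) g i `^ s.
Proof.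
move=> s0 s1 g0; set U := \esum_(i in D) g i `^ s.
have U0 : 0 <= U by apply: esum_ge0 => *; exact: poweR_ge0.
have [->|Uy] := eqVneq U +oo; first by rewrite leey.
have sum0 : 0 <= \esum_(i in D) g i by exact: esum_ge0.
have Uf : U \is a fin_num by rewrite ge0_fin_numE// ltey.
have -> : U = (U `^ s^-1) `^ s by rewrite -poweRrM mulVf ?gt_eqF// poweRe1.
apply: gt0_ler_poweR; [exact: ltW|by rewrite in_itv/= sum0 leey| |].
  by rewrite in_itv/= poweR_ge0 leey.
have -> : U `^ s^-1 = (fine U `^ (s^-1 - 1))%:E * U.
  rewrite -{1 3}(fineK Uf) poweR_EFin -EFinM; congr EFin.
  have [->|u0] := eqVneq (fine U) 0%R.
    by rewrite mulr0 powR0// invr_neq0 ?gt_eqF.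
  rewrite -[X in (_ * X)%R]powRr1 ?fine_ge0// -powRD ?subrK//.
  by rewrite u0 implybT.
set c := (fine U `^ _)%R; rewrite /U -esumZl ?powR_ge0//; last first.
  by move=> *; exact: poweR_ge0.
apply: le_esum => i Di.
have gU : g i `^ s <= U.
  by apply: (@esum_ge_term R _ D (fun i => g i `^ s)) => // j _; exact: poweR_ge0.
have gsf : g i `^ s \is a fin_num by rewrite ge0_fin_numE ?poweR_ge0// (le_lt_trans gU)// ltey.
have gf : g i \is a fin_num.
  by rewrite ge0_fin_numE ?g0// (@lty_poweRy _ _ s) ?gt_eqF// (le_lt_trans gU)// ltey.
have := g0 _ Di; rewrite -(fineK gf) lee_fin => r0.
move: gU; rewrite -(fineK gf) poweR_EFin -(fineK Uf) !lee_fin => gU.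
rewrite /= /c; set r := fine (g i) in r0 gU *.
have [->|rn0] := eqVneq r 0%R; first by rewrite mulr_ge0// powR_ge0.
have {1}-> : (r = (r `^ s) `^ (s^-1 - 1) * r `^ s)%R.
  rewrite -powRrM -powRD ?rn0 ?implybT//.
  by rewrite mulrBr mulfV ?gt_eqF// mulr1 subrK powRr1.
rewrite ler_wpM2r ?powR_ge0// ge0_ler_powR ?nnegrE ?powR_ge0//.
  by rewrite subr_ge0 invf_ge1.
by rewrite fine_ge0.
Qed.

(* Tangent line at [l] of the concave function [x `^ s]. *)
Lemma poweR_le_tangent (R : realType) (g : \bar R) (l s : R) :
  (0 < s)%R -> (s <= 1)%R -> (0 < l)%R -> 0 <= g ->
  g `^ s <= (l `^ s * (s / l))%:E * g + (l `^ s * (1 - s))%:E.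
Proof.
move=> s0 s1 l0; case: g => [r|_|//]; last first.
  rewrite gt0_muley ?lte_fin ?mulr_gt0 ?powR_gt0 ?invr_gt0//.
  by rewrite addye// leey.
rewrite lee_fin => r0; rewrite poweR_EFin -EFinM -EFinD lee_fin.
(* Rescaling by [l] reduces the claim to the tangent at 1: q^s <= s q + (1 - s). *)
have -> : (r = r / l * l)%R by rewrite divfK ?gt_eqF//.
set q := (r / l)%R; have q0 : (0 <= q)%R by rewrite divr_ge0 ?(ltW l0).
rewrite powRM ?(ltW l0)// mulrC.
have -> : (l `^ s * (s / l) * (q * l) + l `^ s * (1 - s) = l `^ s * (s * q + (1 - s)))%R.
  by field; rewrite gt_eqF//.
rewrite ler_wpM2l ?powR_ge0//.
have [->|sn1] := eqVneq s 1%R; first by rewrite powRr1//; lra.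
have s1' : (0 < 1 - s)%R by rewrite subr_gt0 lt_neqAle sn1.
(* Young's inequality for q^s and 1 with conjugate exponents 1/s and 1/(1-s); this is why s = 1 was
   treated apart. *)
have := @conjugate_powR _ (q `^ s)%R 1%R s^-1%R (1 - s)^-1%R (powR_ge0 _ _) ler01.
rewrite !invr_gt0 !invrK -powRrM mulfV ?gt_eqF// powRr1// powR1 mulr1 mul1r.
by rewrite [(s * q)%R]mulrC; apply => //; rewrite addrC subrK.
Qed.

End Concavity.

(** * Square sums over sets of dyadic intervals and their integrals *)

Section SquareSums.
Local Open Scope ereal_scope.
Context (R : realType).
Implicit Types (x v : dyadic -> R) (D : set dyadic) (I J : dyadic).

(** The square of the square function of the part of the series on [D]; without the root it is a
    plain sum that can be integrated termwise. *)
Definition sqsum D x (t : R) : \bar R :=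
  \esum_(I in D) (x I ^+ 2 * \1_(dint I) t)%:E.

(** The squared L^2 norm of the part of the series on [D]. *)
Definition energy D x : \bar R := \esum_(I in D) (x I ^+ 2 * dlen R I)%:E.

Lemma dlen_gt0 I : (0 < dlen R I)%R.
Proof. by rewrite invr_gt0 exprn_gt0. Qed.

Lemma measurable_dint I : measurable (dint I : set (measurableTypeR R)).
Proof. exact: measurable_itv. Qed.

Lemma lebesgue01_dint I : lebesgue01 R (dint I) = (dlen R I)%:E.
Proof.
(* A dyadic interval lies inside [0, 1], so the restriction of the measure does not change its
   length. *)
rewrite /lebesgue01/= /mrestr setIidl; last first.
  move=> t; rewrite /dint/= !in_itv/= => /andP[It tI]; apply/andP; split.
    by apply: le_trans It; rewrite divr_ge0// exprn_ge0.
  apply/ltW/(lt_le_trans tI); rewrite ler_pdivrMr ?exprn_gt0// mul1r -natrX.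
  by rewrite ler_nat ltn_ord.
rewrite lebesgue_measure_itv/= lte_fin ltr_pM2r ?invr_gt0 ?exprn_gt0// ltr_nat.
by rewrite ltnSn -EFinD -mulrBl -natr1 addrAC subrr add0r mul1r.
Qed.

(** Selects the essential supremum in the definition of the norm with exponent +oo, which depends on
    the total mass being positive. *)
Lemma lebesgue01_setT_gt0 : 0 < lebesgue01 R setT.
Proof.
rewrite /lebesgue01/= /mrestr setTI lebesgue_measure_itv/= lte_fin ltr01.
by rewrite oppr0 adde0 lte_fin ltr01.
Qed.

Lemma sqterm_ge0 x I t : 0 <= (x I ^+ 2 * \1_(dint (R:=R) I) t : R)%:E.
Proof. by rewrite lee_fin mulr_ge0 ?sqr_ge0. Qed.

Lemma enterm_ge0 x I : 0 <= (x I ^+ 2 * dlen R I)%:E.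
Proof. by rewrite lee_fin mulr_ge0 ?sqr_ge0 ?ltW ?dlen_gt0. Qed.

Lemma sqsum_ge0 D x t : 0 <= sqsum D x t.
Proof. by apply: esum_ge0 => I _; exact: sqterm_ge0. Qed.

Lemma energy_ge0 D x : 0 <= energy D x.
Proof. by apply: esum_ge0 => I _; exact: enterm_ge0. Qed.

Lemma measurable_indic_dint I :
  measurable_fun setT (fun t : measurableTypeR R => (\1_(dint (R:=R) I) t : R)%:E).
Proof. apply/measurable_EFinP; exact: measurable_indic (measurable_dint I). Qed.

Lemma measurable_sqterm x I : measurable_fun setT
  (fun t : measurableTypeR R => (x I ^+ 2 * \1_(dint I) t)%:E).
Proof.
apply/measurable_EFinP; apply: measurable_funM; first exact: measurable_cst.
exact: measurable_indic (measurable_dint I).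
Qed.

Lemma measurable_sqsum D x :
  measurable_fun setT (sqsum D x : measurableTypeR R -> \bar R).
Proof.
apply: measurable_esum => [I t _|I _]; first exact: sqterm_ge0.
exact: measurable_sqterm.
Qed.

Lemma measurable_sqsum_poweR D x r :
  measurable_fun setT (fun t : measurableTypeR R => sqsum D x t `^ r).
Proof. exact: (measurableT_comp (measurable_poweR r)) (measurable_sqsum D x). Qed.

Lemma integral_indic_dint I :
  \int[lebesgue01 R]_t (\1_(dint I) t)%:E = (dlen R I)%:E.
Proof. by rewrite integral_indic ?setIT ?lebesgue01_dint//; exact: measurable_dint. Qed.

Lemma integral_sqsum D x : \int[lebesgue01 R]_t sqsum D x t = energy D x.
Proof.
rewrite integral_esum; last 2 first.
  by move=> I t _; exact: sqterm_ge0.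
  by move=> I _; exact: measurable_sqterm.
apply: eq_esum => I _; under eq_integral do rewrite EFinM.
rewrite ge0_integralZl//; last 2 first.
- exact: measurable_indic_dint.
- by rewrite lee_fin sqr_ge0.
by rewrite integral_indic_dint.
Qed.

Lemma sqsum_restr_coef D x t : sqsum setT (restr_coef D x) t = sqsum D x t.
Proof.
rewrite /sqsum [RHS]esum_mkcond; apply: eq_esum => I _.
by rewrite /restr_coef indicE; case: ifPn; rewrite (mulr1, mulr0)// expr0n mul0r.
Qed.

Lemma sqsum_eq0 D x t : (forall I, D I -> x I = 0%R) -> sqsum D x t = 0.
Proof. by move=> x0; apply: esum1 => I /x0->; rewrite expr0n mul0r. Qed.

Lemma sqsum_notin D x J t : (forall I, D I -> dint (R:=R) I `<=` dint J) ->
  ~ dint J t -> sqsum D x t = 0.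
Proof.
move=> DJ Jt; apply: esum1 => I DI; rewrite indicE memNset ?mulr0//.
by move=> /(DJ _ DI).
Qed.

(** * Hardy norms in terms of square sums and energies *)

Lemma Hnorm_ge0 p x : 0 <= Hnorm p x.
Proof. exact: Lnorm_ge0. Qed.

(** S^p = (S^2)^(p/2): both roots disappear, and the norm is governed by the concave power p/2 of a
    sum. *)
Lemma poweR_Hnorm p x : (0 < p)%R ->
  Hnorm p x `^ p = \int[lebesgue01 R]_t sqsum setT x t `^ (p / 2).
Proof.
move=> p0; rewrite /Hnorm poweR_Lnorm ?gt_eqF//; apply: eq_integral => t _.
rewrite gee0_abs ?sqrte_ge0// /square_fun -poweR12_sqrt ?sqsum_ge0// -poweRrM.
by rewrite [(p / 2)%R]mulrC.
Qed.

Lemma Hnorm2_restr_coef D x :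
  Hnorm 2%R (restr_coef D x) = energy D x `^ 2^-1.
Proof.
transitivity ((Hnorm 2%R (restr_coef D x) `^ 2) `^ 2^-1).
  by rewrite -poweRrM divff// poweRe1 ?Hnorm_ge0.
rewrite poweR_Hnorm// divff// -integral_sqsum; congr (_ `^ _).
by apply: eq_integral => t _; rewrite poweRe1 ?sqsum_ge0// sqsum_restr_coef.
Qed.

(** The squared square function vanishes off [J] and is almost everywhere at most the square of its
    essential supremum; integrate over [J]. *)
Lemma energy_le_sup D x J : (forall I, D I -> dint (R:=R) I `<=` dint J) ->
  energy D x <=
  (dlen R J)%:E * Lnorm (lebesgue01 R) +oo (square_fun (restr_coef D x)) `^ 2.
Proof.
move=> DJ; set M := Lnorm _ _ _.
have MP : \forall t \ae lebesgue01 R, square_fun (restr_coef D x) t <= M.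
  rewrite /M unlock lebesgue01_setT_gt0.
  apply: filterS (ess_sup_ge (lebesgue01 R) (abse \o square_fun (restr_coef D x))).
  by move=> t /=; rewrite gee0_abs ?sqrte_ge0.
rewrite -integral_indic_dint muleC -ge0_integralZl//; last 2 first.
- exact: measurable_indic_dint.
- exact: poweR_ge0.
rewrite -integral_sqsum; apply: ae_ge0_le_integral => //.
- by move=> t _; exact: sqsum_ge0.
- exact: measurable_sqsum.
- by move=> t _; rewrite mule_ge0 ?poweR_ge0// lee_fin.
- apply: emeasurable_funM; first exact: measurable_cst.
  exact: measurable_indic_dint.
apply: (@filterS _ _ (ae_filter_ringOfSetsType (lebesgue01 R)) _ _ _ MP) => t tM _; rewrite indicE.
have [Jt|Jt] := pselect (dint J t); last first.
  by rewrite (@sqsum_notin _ _ J)// memNset// mule0.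
rewrite mem_set// mule1 -sqsum_restr_coef.
have -> : sqsum setT (restr_coef D x) t =
    square_fun (restr_coef D x) t `^ 2.
  by rewrite /square_fun -poweR12_sqrt ?sqsum_ge0// -poweRrM mulVf// poweRe1 ?sqsum_ge0.
apply: gt0_ler_poweR => //; rewrite in_itv/= leey andbT ?sqrte_ge0//.
by rewrite /M Lnorm_ge0.
Qed.

(** Integrates the tangent bound at [l]. Off [J] the square sum is zero, so the constant term is
    paid only on [J]. *)
Lemma integral_sqsum_poweR_le D x J (s l : R) :
  (0 < s)%R -> (s <= 1)%R -> (0 < l)%R -> (forall I, D I -> dint (R:=R) I `<=` dint J) ->
  \int[lebesgue01 R]_t (sqsum D x t `^ s) <=
  (l `^ s * (s / l))%:E * energy D x + (l `^ s * (1 - s) * dlen R J)%:E.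
Proof.
move=> s0 s1 l0 DJ; set a := (l `^ s * (s / l))%R; set b := (l `^ s * (1 - s))%R.
have a0 : (0 <= a)%R by rewrite !mulr_ge0 ?powR_ge0 ?invr_ge0// ltW.
have b0 : (0 <= b)%R by rewrite mulr_ge0 ?powR_ge0// subr_ge0.
have af0 t : 0 <= a%:E * sqsum D x t by rewrite mule_ge0 ?sqsum_ge0.
have bf0 t : 0 <= b%:E * (\1_(dint J) t)%:E by rewrite mule_ge0 ?lee_fin.
have maf : measurable_fun setT (fun t : measurableTypeR R => a%:E * sqsum D x t).
  by apply: emeasurable_funM; [exact: measurable_cst|exact: measurable_sqsum].
have mbf : measurable_fun setT (fun t : measurableTypeR R => b%:E * (\1_(dint (R:=R) J) t : R)%:E).
  by apply: emeasurable_funM; [exact: measurable_cst|exact: measurable_indic_dint].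
rewrite -integral_sqsum (EFinM b) -integral_indic_dint.
rewrite -ge0_integralZl//; last 2 first.
- exact: measurable_sqsum.
- by move=> t _; exact: sqsum_ge0.
rewrite -ge0_integralZl//; last exact: measurable_indic_dint.
rewrite -ge0_integralD//; apply: ge0_le_integral => //.
- by move=> t _; exact: poweR_ge0.
- exact: measurable_sqsum_poweR.
- exact: emeasurable_funD.
move=> t _; have [Jt|Jt] := pselect (dint J t); last first.
  by rewrite (@sqsum_notin _ _ J)// poweR0r ?gt_eqF// adde_ge0// mule0.
by rewrite indicE mem_set// mule1 poweR_le_tangent// sqsum_ge0.
Qed.

(** One nonzero coefficient x_J suffices: S^2 >= x_J^2 on [J], hence the p-th power of the norm is
    at least |x_J|^p |J|. *)
Lemma Hnorm_gt0 p x : (0 < p)%R -> x <> (fun=> 0%R) -> 0 < Hnorm p x.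
Proof.
move=> p0 xn0; have [J xJ] : exists J, x J <> 0%R.
  by apply: contrapT => /forallNP xP; apply/xn0/funext => J; exact: contrapT.
apply: (@gt0_poweR _ _ p) => //; first exact: Hnorm_ge0.
rewrite poweR_Hnorm//.
have c0 : (0 < (x J ^+ 2) `^ (p / 2))%R.
  by rewrite powR_gt0// exprn_even_gt0//; exact/eqP.
have : 0 < ((x J ^+ 2) `^ (p / 2))%:E * (dlen R J)%:E.
  by rewrite mule_gt0 ?lte_fin// dlen_gt0.
move=> /lt_le_trans; apply.
rewrite -integral_indic_dint -ge0_integralZl//; last 2 first.
- exact: measurable_indic_dint.
- by rewrite lee_fin ltW.
apply: ge0_le_integral => //.
- by move=> t _; rewrite mule_ge0 ?lee_fin// ltW.
- apply: emeasurable_funM; first exact: measurable_cst.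
  exact: measurable_indic_dint.
- exact: measurable_sqsum_poweR.
move=> t _; rewrite indicE.
have [Jt|Jt] := pselect (dint J t); last by rewrite memNset// mule0 poweR_ge0.
rewrite mem_set// mule1 -poweR_EFin.
apply: gt0_ler_poweR; rewrite ?in_itv/= ?leey ?sqsum_ge0 ?lee_fin ?sqr_ge0//.
  by rewrite divr_ge0// ltW.
have := @esum_ge_term R _ setT (fun I => (x I ^+ 2 * \1_(dint I) t)%:E) J.
by rewrite indicE mem_set// mulr1; apply => // I _; exact: sqterm_ge0.
Qed.

End SquareSums.
(** Splits lengths and energies into two real powers, which [field] can then cancel as independent
    factors. *)
Lemma powR_mulrB1 (R : realType) (r s : R) : 0 < r -> r `^ s * r `^ (1 - s) = r.
Proof.
move=> r0; have sE : s + (1 - s) = 1 by rewrite addrC subrK.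
by rewrite -powRD sE ?powRr1 ?ltW// oner_eq0.
Qed.

(** * Bounds on the atoms of a fixed decomposition *)

Section AtomicDecomposition.
Local Open Scope ereal_scope.
Context (R : realType) (p A : R) (p_gt0 : (0 < p)%R) (p_le2 : (p <= 2)%R).
Context (x : dyadic -> R) (x_Hardy : in_Hardy p x) (x_neq0 : x <> (fun=> 0%R)).
Context (N : set nat) (G : nat -> set dyadic) (top : nat -> dyadic).
Context (dec : atomic_decomposition p A x N G top).

Let s : R := (p / 2)%R.
Let U : R := (fine (Hnorm p x) `^ p)%R.
Let L i : R := dlen R (top i).
Let E i : R := fine (energy (G i) x).
(** Equals |I_i|^(1-p/2) ||u_i||_2^p, the quantity compared with the i-th term of (iii). *)
Let b i : R := (L i `^ (1 - s) * E i `^ s)%R.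
(** The factor of [omega] that is constant on the i-th block; E^(1-s) is ||u_i||_2^(2-p). *)
Let k i : R := (A^-1 * (L i `^ (1 - s) / E i `^ (1 - s)) / U)%R.

Let s_gt0 : (0 < s)%R. Proof. by rewrite divr_gt0. Qed.

Let s_le1 : (s <= 1)%R. Proof. by rewrite ler_pdivrMr ?mul1r. Qed.

Let L_gt0 i : (0 < L i)%R. Proof. exact: dlen_gt0. Qed.

Let E_ge0 i : (0 <= E i)%R. Proof. by rewrite fine_ge0// energy_ge0. Qed.

Let b_ge0 i : (0 <= b i)%R. Proof. by rewrite mulr_ge0 ?powR_ge0. Qed.

Let Hnorm_fin_num : Hnorm p x \is a fin_num.
Proof. by rewrite ge0_fin_numE ?Hnorm_ge0. Qed.

Let poweR_HnormE : Hnorm p x `^ p = U%:E.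
Proof. by rewrite -poweR_EFin fineK. Qed.

Let U_gt0 : (0 < U)%R.
Proof.
by rewrite /U powR_gt0// fine_gt0// Hnorm_gt0.
Qed.

(** The chain (iii) reads U <= A U, and U is positive and finite. *)
Lemma atomic_decomposition_ge1 : (1 <= A)%R.
Proof.
have := le_trans (atomic_lower dec) (le_trans (atomic_middle dec) (atomic_upper dec)).
by rewrite poweR_HnormE -EFinM lee_fin ler_pMl.
Qed.

Let A_gt0 : (0 < A)%R.
Proof. exact: lt_le_trans ltr01 atomic_decomposition_ge1. Qed.

Let k_ge0 i : (0 <= k i)%R.
Proof. by rewrite !mulr_ge0 ?invr_ge0 ?powR_ge0// ltW. Qed.

Let dint_top i J : N i -> G i J -> dint (R:=R) J `<=` dint (top i).
Proof. by move=> Ni GJ t Jt; rewrite (atomic_top dec)//; exists J. Qed.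

(** With M the supremum norm of S(u_i), E <= L M^2 gives L^(1-s) E^s <= L^(1-s) L^s M^(2s) = L
    M^p. *)
Let atom_sup_le i : N i ->
  energy (G i) x \is a fin_num /\
  (b i)%:E <= (L i)%:E *
    Lnorm (lebesgue01 R) +oo (square_fun (restr_coef (G i) x)) `^ p.
Proof.
move=> Ni; set M := Lnorm _ _ _.
have M0 : 0 <= M by exact: Lnorm_ge0.
have EM : energy (G i) x <= (L i)%:E * M `^ 2.
  by apply: energy_le_sup => I; exact: dint_top.
(* A single term of the sum in (iii) is at most A U, so M, and with it the energy, is finite. *)
have Mp : (L i)%:E * M `^ p < +oo.
  have /le_lt_trans : (L i)%:E * M `^ p <= A%:E * Hnorm p x `^ p.
    apply: le_trans (atomic_upper dec).
    apply: (@esum_ge_term R _ N (fun i => (L i)%:E *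
      Lnorm (lebesgue01 R) +oo (square_fun (restr_coef (G i) x)) `^ p)) => //.
    by move=> j _; rewrite mule_ge0 ?poweR_ge0// lee_fin ltW.
  by apply; rewrite poweR_HnormE -EFinM ltry.
have Mf : M \is a fin_num.
  rewrite ge0_fin_numE// ltey; apply/eqP => My; move: Mp.
  by rewrite My poweRyr ?gt_eqF// gt0_muley ?lte_fin.
move: M0 EM; rewrite -(fineK Mf); set m := fine M; rewrite lee_fin => m0.
rewrite !poweR_EFin -!EFinM => EM.
have Ef : energy (G i) x \is a fin_num.
  by rewrite ge0_fin_numE ?energy_ge0// (le_lt_trans EM) ?ltry.
split=> //; move: EM; rewrite -(fineK Ef) !lee_fin -/(E i) => EM.
have : (E i `^ s <= (L i * m `^ 2) `^ s)%R.
  by rewrite ge0_ler_powR ?nnegrE ?mulr_ge0 ?powR_ge0// ltW.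
rewrite powRM ?powR_ge0 ?(ltW (L_gt0 i))// -powRrM.
have -> : (2 * s = p)%R by rewrite /s mulrC divfK.
move=> Es; apply: le_trans (_ : (L i `^ (1 - s) * (L i `^ s * m `^ p) <= _)%R).
  by rewrite ler_wpM2l ?powR_ge0.
rewrite mulrA -powRD ?subrK ?powRr1 ?(ltW (L_gt0 i))//.
by rewrite oner_eq0.
Qed.

Let energyE i : N i -> energy (G i) x = (E i)%:E.
Proof. by move=> Ni; rewrite fineK//; case: (atom_sup_le Ni). Qed.

Let esum_b : \esum_(i in N) (b i)%:E <= (A * U)%:E.
Proof.
rewrite EFinM -poweR_HnormE; apply: le_trans (atomic_upper dec).
by apply: le_esum => i Ni; case: (atom_sup_le Ni).
Qed.

(** * The weights and their total mass *)

Lemma omegaE i I : N i -> G i I ->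
  omega p A x N G top I = (k i * (x I ^+ 2 * dlen R I))%R.
Proof.
move=> Ni GI; rewrite /omega; case: eqP => [->|_]; first by rewrite expr0n mul0r mulr0.
(* Disjointness of the blocks leaves [i] as the only candidate. *)
have -> : block_index N G I = i.
  apply: xget_unique => // j [Nj GJ].
  by apply: (atomic_trivIset dec) => //; exists I.
rewrite Hnorm2_restr_coef fine_poweR -/(E i) -powRrM real_normK ?num_real//.
have -> : (2^-1 * (2 - p) = 1 - s)%R by rewrite mulrBr mulVf// mulrC.
by rewrite -/U -/(L i) -/s /k; ring.
Qed.

Lemma omega_ge0 I : (0 <= omega p A x N G top I)%R.
Proof.
have [i Ni GI] : (\bigcup_(i in N) G i) I by rewrite (atomic_cover dec).
by rewrite (omegaE Ni GI) mulr_ge0// mulr_ge0 ?sqr_ge0// ltW// dlen_gt0.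
Qed.

(** The mass of [omega] on the i-th block, from E = E^s E^(1-s); for E = 0 both sides vanish because
    s > 0. *)
Let kE i : (k i * E i = (A * U)^-1 * b i)%R.
Proof.
rewrite /k /b; have [->|En0] := eqVneq (E i) 0%R.
  by rewrite mulr0 powR0 ?gt_eqF// !mulr0.
have Ei0 : (0 < E i)%R by rewrite lt0r En0 E_ge0.
rewrite -[X in (_ * X = _)%R](powR_mulrB1 s Ei0).
by field; rewrite !gt_eqF// powR_gt0.
Qed.

Lemma esum_omega_mul (phi : dyadic -> R) :
  \esum_(I in setT) (`|phi I| ^+ 2 * omega p A x N G top I)%:E =
  \esum_(i in N) ((k i)%:E * energy (G i) (fun I => phi I * x I)%R).
Proof.
rewrite (esum_partition (atomic_trivIset dec) (atomic_cover dec)); last first.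
  by move=> I; rewrite lee_fin mulr_ge0 ?sqr_ge0 ?omega_ge0.
apply: eq_esum => i Ni; rewrite -esumZl//; last first.
  by move=> I _; exact: (enterm_ge0 (fun I => phi I * x I)%R).
apply: eq_esum => I GI; rewrite (omegaE Ni GI) -EFinM real_normK ?num_real//.
by congr EFin; ring.
Qed.

Lemma esum_omega_le1 : \esum_(I in setT) (omega p A x N G top I)%:E <= 1.
Proof.
have -> : \esum_(I in setT) (omega p A x N G top I)%:E =
    \esum_(i in N) (((A * U)^-1)%:E * (b i)%:E).
  (* The total mass is the case phi = 1 of the weighted sum. *)
  transitivity (\esum_(I in setT) (`|(1:R)| ^+ 2 * omega p A x N G top I)%:E).
    by apply: eq_esum => I _; rewrite normr1 expr1n mul1r.
  rewrite (esum_omega_mul (fun=> 1%R)); apply: eq_esum => i Ni.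
  rewrite (_ : (fun I => _) = x); last by apply/funext => I; rewrite mul1r.
  by rewrite energyE// -!EFinM kE.
have AU0 : (0 < A * U)%R by rewrite mulr_gt0.
rewrite esumZl ?invr_ge0 ?(ltW AU0)//; last by move=> i _; rewrite lee_fin.
apply: le_trans (_ : ((A * U)^-1)%:E * (A * U)%:E <= _).
  by rewrite lee_wpmul2l// lee_fin invr_ge0 ltW.
by rewrite -EFinM mulVf ?gt_eqF.
Qed.

(** * The norm inequality, first on one block and then summed *)

(* The tangent is taken at [l = t * E i / L i], [t] times the mean of the
   squared atom over [top i]. *)
Let block_le v i (t : R) : N i -> (0 < t)%R -> (forall I, x I = 0%R -> v I = 0%R) ->
  \int[lebesgue01 R]_r (sqsum (G i) v r `^ s) <=
  (t `^ s * (s / t) * (A * U))%:E * ((k i)%:E * energy (G i) v) +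
  (t `^ s * (1 - s))%:E * (b i)%:E.
Proof.
move=> Ni t0 xv.
(* For E = 0 the tangent point would be 0. In that case all x_I on the block vanish, hence so does
   [v], and the integral is zero. *)
have [E0|En0] := eqVneq (E i) 0%R.
  have v0 I : G i I -> v I = 0%R.
    move=> GI; apply: xv; have : (x I ^+ 2 * dlen R I)%:E <= 0.
      have -> : 0 = energy (G i) x by rewrite energyE// E0.
      apply: (@esum_ge_term R _ (G i) (fun I => (x I ^+ 2 * dlen R I)%:E)) => //.
      by move=> J _; exact: enterm_ge0.
    rewrite lee_fin pmulr_lle0 ?dlen_gt0// => x2.
    by apply/eqP; rewrite -sqrf_eq0 eq_le x2 sqr_ge0.
  under eq_integral do rewrite sqsum_eq0// poweR0r ?(gt_eqF s_gt0)//.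
  rewrite integral0 adde_ge0// mule_ge0 ?mule_ge0 ?energy_ge0 ?lee_fin//.
    by rewrite !mulr_ge0 ?powR_ge0 ?invr_ge0// ltW.
  by rewrite mulr_ge0 ?powR_ge0// subr_ge0.
have Ei0 : (0 < E i)%R by rewrite lt0r En0 E_ge0.
pose l := (t * E i / L i)%R; have l0 : (0 < l)%R by rewrite divr_gt0// mulr_gt0.
apply: le_trans (integral_sqsum_poweR_le _ s_gt0 s_le1 l0 (fun I => @dint_top i I Ni)) _.
have ls : (l `^ s = t `^ s * E i `^ s / L i `^ s)%R.
  apply: (@mulIf _ (L i `^ s)%R); first by rewrite gt_eqF// powR_gt0.
  rewrite divfK ?gt_eqF ?powR_gt0// -!powRM ?(ltW t0) ?(ltW l0) ?(ltW (L_gt0 i))//.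
  by rewrite /l divfK// gt_eqF.
have lE : l = (t * (E i `^ s * E i `^ (1 - s)) / (L i `^ s * L i `^ (1 - s)))%R.
  by rewrite !powR_mulrB1.
(* The slope is (t^s s / t) (L/E)^(1-s), and A U cancels the normalization inside [k i]. *)
have -> : (l `^ s * (s / l) = t `^ s * (s / t) * (A * U) * k i)%R.
  by rewrite ls lE /k; field; rewrite !gt_eqF// powR_gt0.
have -> : (l `^ s * (1 - s) * dlen R (top i) = t `^ s * (1 - s) * b i)%R.
  rewrite ls /b -[X in (_ * X = _)%R](powR_mulrB1 s (L_gt0 i)).
  by field; rewrite gt_eqF// powR_gt0.
by rewrite muleA -!EFinM.
Qed.

Lemma Hnorm_le_esum_omega (phi : dyadic -> R) :
  Hnorm p (fun I => phi I * x I)%R <= (A `^ p^-1)%:E * Hnorm p x *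
    (\esum_(I in setT) (`|phi I| ^+ 2 * omega p A x N G top I)%:E) `^ 2^-1.
Proof.
set v := (fun I => _); set S := \esum_(I in setT) _.
have phio_ge0 I : 0 <= (`|phi I| ^+ 2 * omega p A x N G top I)%:E.
  by rewrite lee_fin mulr_ge0 ?sqr_ge0 ?omega_ge0.
have S0 : 0 <= S by exact: esum_ge0.
have Hx0 : 0 < Hnorm p x by exact: Hnorm_gt0.
have AH0 : 0 < (A `^ p^-1)%:E * Hnorm p x.
  by rewrite mule_gt0// lte_fin powR_gt0.
have [->|Sy] := eqVneq S +oo; first by rewrite poweRyr// gt0_muley ?leey.
have Sf : S \is a fin_num by rewrite ge0_fin_numE// ltey.
have [SE0|Sn0] := eqVneq S 0.
  (* The tangent argument needs t > 0. If S = 0, then phi_I = 0 wherever x_I is nonzero, since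
     omega_I > 0 there; so phi x = 0. *)
  have v0 : v = (fun=> 0%R).
    apply/funext => I; rewrite /v; have [->|xI] := eqVneq (x I) 0%R; first exact: mulr0.
    have [i Ni GI] : (\bigcup_(i in N) G i) I by rewrite (atomic_cover dec).
    have xI0 : (0 < x I ^+ 2 * dlen R I)%R.
      by rewrite mulr_gt0 ?dlen_gt0// exprn_even_gt0.
    have Ei0 : (0 < E i)%R.
      rewrite (lt_le_trans xI0)// -lee_fin -energyE//.
      apply: (@esum_ge_term R _ (G i) (fun I => (x I ^+ 2 * dlen R I)%:E)) => //.
      by move=> J _; exact: enterm_ge0.
    have : (`|phi I| ^+ 2 * omega p A x N G top I)%:E <= 0.
      rewrite -SE0; exact: (@esum_ge_term R _ setT
        (fun I => (`|phi I| ^+ 2 * omega p A x N G top I)%:E)).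
    rewrite lee_fin (omegaE Ni GI) pmulr_lle0; last first.
      by rewrite mulr_gt0// divr_gt0// mulr_gt0 ?divr_gt0 ?invr_gt0 ?powR_gt0.
    move=> phi0; suff -> : phi I = 0%R by rewrite mul0r.
    apply/eqP; rewrite -normr_eq0 -sqrf_eq0 eq_le phi0 sqr_ge0//.
  apply: le_trans (_ : 0 <= _); last by rewrite mule_ge0 ?poweR_ge0// ltW.
  rewrite le_eqVlt; apply/orP; left; apply/eqP.
  apply: (@poweR_eq0_eq0 _ _ p); first exact: Hnorm_ge0.
  rewrite poweR_Hnorm//; under eq_integral do
    rewrite v0 sqsum_eq0// poweR0r ?(gt_eqF s_gt0)//.
  by rewrite integral0.
pose t := fine S; have SE : S = t%:E by rewrite fineK.
have t0 : (0 < t)%R by rewrite -lte_fin -SE lt0e Sn0.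
have AU0 : (0 < A * U)%R by rewrite mulr_gt0.
have ts0 : (0 < t `^ s)%R by rewrite powR_gt0.
have Hp : Hnorm p v `^ p <= (t `^ s * (A * U))%:E.
  rewrite poweR_Hnorm//.
  (* Pointwise subadditivity of the power s separates the blocks. *)
  apply: (@le_trans _ _ (\int[lebesgue01 R]_r \esum_(i in N) (sqsum (G i) v r `^ s))).
    apply: ge0_le_integral => //.
    - by move=> r _; exact: poweR_ge0.
    - exact: measurable_sqsum_poweR.
    - apply: measurable_esum => [i r _|i _]; first exact: poweR_ge0.
      exact: measurable_sqsum_poweR.
    move=> r _; rewrite /sqsum.
    rewrite (esum_partition (atomic_trivIset dec) (atomic_cover dec)); last first.
      by move=> I; exact: sqterm_ge0.
    by apply: poweR_esum_le => // i _; exact: sqsum_ge0.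
  rewrite integral_esum; last 2 first.
    by move=> i r _; exact: poweR_ge0.
    by move=> i _; exact: measurable_sqsum_poweR.
  have c10 : (0 <= t `^ s * (s / t) * (A * U))%R.
    by rewrite ltW// !mulr_gt0 ?invr_gt0.
  have c20 : (0 <= t `^ s * (1 - s))%R by rewrite mulr_ge0 ?subr_ge0 ?(ltW ts0).
  have ke0 i : 0 <= (k i)%:E * energy (G i) v by rewrite mule_ge0 ?energy_ge0 ?lee_fin.
  have xv I : x I = 0%R -> v I = 0%R by rewrite /v => ->; rewrite mulr0.
  apply: (le_trans (le_esum (fun i Ni => block_le Ni t0 xv))).
  rewrite esumD; last 2 first.
    by move=> i _; rewrite mule_ge0.
    by move=> i _; rewrite mule_ge0 ?lee_fin.
  rewrite !esumZl//; last by move=> i _; rewrite lee_fin.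
  have <- : S = \esum_(i in N) ((k i)%:E * energy (G i) v) by exact: esum_omega_mul.
  rewrite SE.
  apply: (@le_trans _ _ ((t `^ s * (s / t) * (A * U))%:E * t%:E +
      (t `^ s * (1 - s))%:E * (A * U)%:E)).
    by rewrite leeD2l// lee_wpmul2l.
  (* Taking t = S turns the two sums into s t^s A U and (1 - s) t^s A U, which add up to t^s A U. *)
  rewrite -!EFinM -EFinD lee_fin le_eqVlt; apply/orP; left; apply/eqP.
  by field; rewrite gt_eqF.
have -> : Hnorm p v = (Hnorm p v `^ p) `^ p^-1.
  by rewrite -poweRrM mulfV ?gt_eqF// poweRe1 ?Hnorm_ge0.
(* It remains to take p-th roots: s / p = 1/2 produces the square root of S. *)
have -> : (A `^ p^-1)%:E * Hnorm p x * S `^ 2^-1 = (t `^ s * (A * U))%:E `^ p^-1.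
  rewrite SE !EFinM -poweR_HnormE !poweRM ?mule_ge0 ?lee_fin ?poweR_ge0 ?(ltW ts0) ?(ltW A_gt0)//.
  rewrite -poweRrM mulfV ?gt_eqF// poweRe1 ?Hnorm_ge0// muleC.
  congr (_ * _); rewrite !poweR_EFin -powRrM; congr (_ `^ _)%:E.
  by rewrite /s mulrAC mulfV ?gt_eqF// mul1r.
by apply: gt0_ler_poweR; rewrite ?invr_ge0 ?in_itv/= ?poweR_ge0 ?leey ?lee_fin// ltW// mulr_gt0.
Qed.

End AtomicDecomposition.

Theorem theorem3p1 (R : realType) (p A : R) (hp0 : 0 < p) (hp2 : p <= 2)
    (hA : atomic_constant p A) :
  exists C : R, 0 < C /\
    forall (x : dyadic -> R), in_Hardy p x -> x <> (fun=> 0) ->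
    forall (N : set nat) (G : nat -> set dyadic) (top : nat -> dyadic),
      atomic_decomposition p A x N G top ->
      (\esum_(I in [set: dyadic]) (omega p A x N G top I)%:E <= 1)%E /\
      forall phi : dyadic -> R, bounded_fun phi ->
        (Hnorm p (fun I => phi I * x I)%R <=
         C%:E * Hnorm p x *
         (\esum_(I in [set: dyadic])
            (`|phi I| ^+ 2 * omega p A x N G top I)%:E) `^ (2^-1))%E.
Proof.
(* The constant must be chosen before the decomposition is given. For A <= 0 no nonzero series has a
   decomposition, as that would force A >= 1, so any positive constant works. *)
have [A_gt0|A_le0] := ltP 0 A.
  exists (A `^ p^-1); split=> [|x xH x0 N G top dec]; first exact: powR_gt0.
  by split=> [|phi _]; [exact: esum_omega_le1|exact: Hnorm_le_esum_omega].
exists 1; split=> // x xH x0 N G top dec; exfalso.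
have := atomic_decomposition_ge1 hp0 xH x0 dec.
by rewrite leNgt (le_lt_trans A_le0 ltr01).
Qed.
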